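(* Let $(x_n)_{n\ge 1}$ be a bounded sequence of nonnegative real numbers. Then $(x_n)$ is Cesàro convergent to $0$ (hence, strongly Cesàro convergent to $0$) if and only if there exists a real number $\alpha>1$ such that $$\lim_{k\to\infty}\frac{1}{\alpha^{k+1}-\alpha^k}\sum_{\alpha^k\le i<\alpha^{k+1}}x_i=0,$$ where $k$ ranges over the nonnegative integers and the sum is over all integers $i$ with $\alpha^k\le i<\alpha^{k+1}$.
   Context: A real sequence $(x_n)_{n\ge 1}$ is Cesàro convergent to $\ell\in\mathbf{R}$ if $\lim_{n\to\infty}\frac{1}{n}\sum_{k=1}^n x_k=\ell$, and strongly Cesàro convergent to $\ell$ if $\lim_{n\to\infty}\frac{1}{n}\sum_{k=1}^n |x_k-\ell|=0$. For a nonnegative sequence and $\ell=0$ these two notions coincide, since $|x_k-0|=x_k$. An empty sum equals $0$. *)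

(* Defs.v *)
From HB Require Import structures.
From mathcomp Require Import all_boot all_order all_algebra.
From mathcomp Require Import all_classical all_reals all_analysis.

Set Implicit Arguments.
Unset Strict Implicit.
Unset Printing Implicit Defensive.

Import Order.TTheory GRing.Theory Num.Theory.
Import numFieldNormedType.Exports.

Local Open Scope classical_set_scope.
Local Open Scope ring_scope.

(* A sequence (x_n)_{n >= 1} is represented by a function x : nat -> R whose
   value at 0 is never used. *)

Definition cesaro_cvg (R : realType) (x : nat -> R) (l : R) : Prop :=
  (fun n : nat => n%:R^-1 * \sum_(1 <= k < n.+1) x k) @ \oo --> l.

Definition strong_cesaro_cvg (R : realType) (x : nat -> R) (l : R) : Prop :=
  (fun n : nat => n%:R^-1 * \sum_(1 <= k < n.+1) `|x k - l|) @ \oo --> (0 : R).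

(* For a > 1 every integer i with a ^+ k <= i is positive, so i may range over
   nat, and 0 is not in the block. *)
Definition geom_block (R : realType) (a : R) (k : nat) : set nat :=
  [set i : nat | a ^+ k <= i%:R < a ^+ k.+1].

(* The finitely-supported sum below has junk value 0 on infinite supports; this
   never happens here. *)
Lemma finite_geom_block (R : realType) (a : R) (k : nat) :
  finite_set (geom_block a k).
Proof.
apply: (@sub_finite_set _ _ `I_(Num.truncn (a ^+ k.+1)).+1).
  move=> i /andP[_ lti] /=; rewrite ltnS.
  rewrite -ltnS -(ltr_nat R); apply: lt_trans lti _.
  exact: truncnS_gt.
exact: finite_II.
Qed.

Definition geom_block_mean (R : realType) (x : nat -> R) (a : R) (k : nat) : R :=
  (a ^+ k.+1 - a ^+ k)^-1 * \sum_(i \in geom_block a k) x i.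

(* Main.v *)
Require Import Defs.
From HB Require Import structures.
From mathcomp Require Import all_boot all_order all_algebra.
From mathcomp Require Import all_classical all_reals all_analysis.

Import Order.TTheory GRing.Theory Num.Theory.
Import numFieldNormedType.Exports.

Local Open Scope classical_set_scope.
Local Open Scope ring_scope.

(* Write S(n) for the partial sum up to n. If S(n)/n tends to 0, then with
   alpha = 2 the k-th block mean is at most S(2^(k+1))/2^k, which tends to 0.
   Conversely, if the block means are at most d from some index N on, then
   summing over the blocks gives S(n) <= C + d * alpha^K <= C + d * alpha * n,
   where K is the least exponent with n < alpha^K and C does not depend on n;
   dividing by n yields the limit 0. *)

(** Interval sums can be split and widened, unlike sums over a set. The hypotheses characterize [m]
    and [n] as ceilings, which covers exact powers of 2 as well. *)
Lemma fsbig_geom_block (R : realType) (x : nat -> R) (a : R) (k m n : nat) :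
    (forall i : nat, (m <= i)%N = (a ^+ k <= i%:R)) ->
    (forall i : nat, (n <= i)%N = (a ^+ k.+1 <= i%:R)) ->
  \sum_(i \in geom_block a k) x i = \sum_(m <= i < n) x i.
Proof.
move=> hm hn; rewrite [RHS]fsbig_seq ?iota_uniq//.
suff -> : geom_block a k = [set` index_iota m n] by [].
by apply/seteqP; split=> i /=; rewrite mem_index_iota hm (ltnNge i n) hn -ltNge.
Qed.

Lemma geom_ceil_nat (R : realType) (a : R) (k : nat) : 1 < a ->
  exists m : nat, forall i : nat, (m <= i)%N = (a ^+ k <= i%:R).
Proof.
move=> a1; have ak : 0 <= a ^+ k by rewrite exprn_ge0// ltW// (lt_trans ltr01).
have c0 : 0 <= Num.ceil (a ^+ k) by rewrite ceil_ge0 (lt_le_trans _ ak)// ltrN10.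
by exists `|Num.ceil (a ^+ k)|%N => i; rewrite -lez_nat gez0_abs// ceil_le_int.
Qed.

(** The powers of [a^-1] tend to 0, hence fall below the inverse of [|y| + 1]. *)
Lemma geom_unbounded (R : realType) (a y : R) : 1 < a ->
  exists k : nat, y < a ^+ k.
Proof.
move=> a1; have a0 : 0 < a by rewrite (lt_trans ltr01).
have y0 : 0 < `|y| + 1 by rewrite ltr_wpDl.
have Va1 : `|a^-1| < 1 by rewrite gtr0_norm ?invr_gt0// invf_lt1.
have /cvgr0Pnorm_lt/(_ (`|y| + 1)^-1) := cvg_expr Va1.
rewrite invr_gt0 => /(_ y0)[k _ /(_ k (leqnn k))] /=.
rewrite exprVn gtr0_norm ?invr_gt0 ?exprn_gt0// ltf_pV2 ?posrE ?exprn_gt0// => h.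
by exists k; rewrite (le_lt_trans (ler_norm y))// (le_lt_trans _ h)// lerDl.
Qed.

Lemma sum_nat_ge0 (R : numDomainType) (x : nat -> R) (m n : nat) :
    (forall k : nat, (1 <= k)%N -> 0 <= x k) ->
  (0 < m)%N -> 0 <= \sum_(m <= i < n) x i.
Proof.
move=> x0 m0; rewrite big_nat_cond; apply: sumr_ge0 => i /andP[/andP[mi _] _].
by rewrite x0// (leq_trans m0).
Qed.

Lemma ler_sum_nat_widen (R : numDomainType) (x : nat -> R) (m m' n n' : nat) :
    (forall k : nat, (1 <= k)%N -> 0 <= x k) ->
    (0 < m')%N -> (m' <= m)%N -> (n <= n')%N ->
  \sum_(m <= i < n) x i <= \sum_(m' <= i < n') x i.
Proof.
move=> x0 m0 mm nn; have [nm|mn] := leqP n m; first by rewrite big_geq ?sum_nat_ge0.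
rewrite (big_cat_nat mm (leq_trans (ltnW mn) nn))/= (big_cat_nat (ltnW mn) nn)/=.
have n0 : (0 < n)%N := leq_trans m0 (leq_trans mm (ltnW mn)).
by rewrite addrCA lerDl addr_ge0 ?sum_nat_ge0.
Qed.

(* The blocks [N <= k < K] tile the integers of [[a ^+ N, a ^+ K[[, and the
   normalizing factors [a ^+ k.+1 - a ^+ k] telescope. The naturals [m] and [n]
   encode the ceilings of [a ^+ N] and [a ^+ K]. *)
Lemma sum_lt_geom_le (R : realType) (x : nat -> R) (a e : R) (N K m n : nat) :
    1 < a -> (N <= K)%N ->
    (forall k, (N <= k)%N -> geom_block_mean x a k <= e) ->
    (forall i : nat, (m <= i)%N = (a ^+ N <= i%:R)) ->
    (forall i : nat, (n <= i)%N = (a ^+ K <= i%:R)) ->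
  \sum_(1 <= i < n) x i <= \sum_(1 <= i < m) x i + e * (a ^+ K - a ^+ N).
Proof.
move=> a1 NK mean_le hm; rewrite -(subnK NK).
elim: (K - N)%N n => [|j IHj] n hn.
  rewrite add0n subrr mulr0 addr0 in hn *.
  by suff -> : n = m by []; apply/eqP; rewrite eqn_leq hn -hm leqnn hm -hn leqnn.
rewrite addSn in hn *; set L := (j + N)%N in IHj hn *.
have NL : (N <= L)%N by exact: leq_addl.
have [p hp] := geom_ceil_nat R a L a1.
have pge1 : (1 <= p)%N.
  by rewrite lt0n -leqn0 hp -ltNge exprn_gt0// (lt_trans ltr01).
have ltL : a ^+ L < a ^+ L.+1 by rewrite ltr_eXn2l.
have pn : (p <= n)%N by rewrite hp (le_trans (ltW ltL))// -hn.
(* Cut at [p], the ceiling of [a ^+ L]: the induction hypothesis bounds the part below, and the part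
   above is exactly block [L]. *)
rewrite (big_cat_nat pge1 pn) /=.
have := mean_le L NL; rewrite /geom_block_mean (fsbig_geom_block _ _ _ _ p n)//.
rewrite ler_pdivrMl ?subr_gt0// => hB.
rewrite (le_trans (lerD (IHj p hp) hB))// -addrA lerD2l.
by rewrite (mulrC _ e) -mulrDr addrC subrKA.
Qed.

Lemma cesaro_cvg_geom_block_mean (R : realType) (x : nat -> R) :
    (forall n : nat, (1 <= n)%N -> 0 <= x n) ->
  cesaro_cvg x 0 -> geom_block_mean x 2 @ \oo --> (0 : R).
Proof.
move=> x0 /cvgr0Pnorm_le cx; apply/cvgr0Pnorm_le => e e0.
(* The mean at [2 ^ k.+1] divides by twice the normalizing factor [2 ^+ k] of the block, so a factor
   2 is lost. *)
have e20 : 0 < e / 2 by rewrite divr_gt0.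
have [N _ hN] := cx _ e20.
exists N => // k /= Nk.
have hp j i : (2 ^ j <= i)%N = (2 ^+ j <= i%:R :> R) by rewrite -natrX ler_nat.
rewrite /geom_block_mean (fsbig_geom_block _ _ _ _ (2 ^ k) (2 ^ k.+1))//.
have -> : 2 ^+ k.+1 - 2 ^+ k = 2 ^+ k :> R by rewrite exprS mulr_natl mulr2n addrK.
have k0 : 0 < 2 ^+ k :> R by rewrite exprn_gt0.
rewrite ger0_norm ?mulr_ge0 ?invr_ge0 ?(ltW k0) ?sum_nat_ge0 ?expn_gt0//.
have := hN (2 ^ k.+1)%N; rewrite /= => /(_ _) h.
have /h {h} : (N <= 2 ^ k.+1)%N.
  by rewrite (leq_trans Nk)// (leq_trans (leqnSn k))// ltnW// ltn_expl.
move=> /(le_trans (ler_norm _)).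
rewrite ler_pdivrMl ?ltr0n ?expn_gt0// natrX exprS => h.
rewrite ler_pdivrMl//.
(* By nonnegativity, the terms before the block and the endpoint [2 ^ k.+1] may be added. *)
apply: le_trans (_ : _ <= \sum_(1 <= i < (2 ^ k.+1).+1) x i) _.
  by apply: ler_sum_nat_widen; rewrite ?expn_gt0.
by rewrite (le_trans h)// mulrAC mulrCA divff ?mulr1 ?pnatr_eq0// mulrC.
Qed.

Lemma geom_block_mean_cesaro_cvg (R : realType) (x : nat -> R) (a : R) :
    (forall n : nat, (1 <= n)%N -> 0 <= x n) -> 1 < a ->
  geom_block_mean x a @ \oo --> (0 : R) -> cesaro_cvg x 0.
Proof.
move=> x0 a1 /cvgr0Pnorm_le ca; apply/cvgr0Pnorm_le => e e0.
have a0 : 0 < a by rewrite (lt_trans ltr01).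
(* Chosen so that [d * (a * n)] is [e / 2 * n]; the other half of [e] will absorb the constant
   [C]. *)
pose d := e / (2 * a); have d0 : 0 < d by rewrite divr_gt0 ?mulr_gt0.
have [N _ hN] := ca _ d0.
have mean_le k : (N <= k)%N -> geom_block_mean x a k <= d.
  by move=> /hN /=; apply: le_trans (ler_norm _).
have [m hm] := geom_ceil_nat R a N a1.
pose C := \sum_(1 <= i < m) x i.
have sum_le n : (0 < n)%N -> \sum_(1 <= k < n.+1) x k <= C + d * (a * n%:R).
  move=> n0.
  have /ex_minnP[K nK minK] : exists k, n%:R < a ^+ k by exact: geom_unbounded.
  (* If [K <= N], then [n < a ^+ N] and the whole sum is already part of [C]. *)
  have [KN|NK] := leqP K N.
    have CB : C <= C + d * (a * n%:R).
      by rewrite lerDl mulr_ge0 ?(ltW d0)// mulr_ge0// ltW.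
    apply: le_trans CB; apply: ler_sum_nat_widen => //; rewrite ltnNge hm -ltNge (lt_le_trans nK)//.
    by rewrite ler_eXn2l.
  have [q hq] := geom_ceil_nat R a K a1.
  apply: le_trans (_ : _ <= \sum_(1 <= i < q) x i) _.
    by apply: ler_sum_nat_widen => //; rewrite ltnNge hq -ltNge.
  apply: le_trans (sum_lt_geom_le R x a d N K m q a1 (ltnW NK) mean_le hm hq) _.
  rewrite lerD2l ler_pM2l//; apply: (@le_trans _ _ (a ^+ K)).
    by rewrite gerBl exprn_ge0// ltW.
  (* Since [N < K], the exponent has a predecessor, whose power is at most [n] by minimality. *)
  case: K NK minK {nK hq} => // K _ minK; rewrite exprS ler_pM2l//.
  by rewrite leNgt; apply/negP => /minK; rewrite ltnn.
near=> n.
have n0 : (0 < n)%N by near: n; exact: nbhs_infty_gt.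
have n0R : 0 < n%:R :> R by rewrite ltr0n.
rewrite ger0_norm ?mulr_ge0 ?invr_ge0 ?sum_nat_ge0// ler_pdivrMl//.
rewrite (le_trans (sum_le _ n0))//.
have -> : d * (a * n%:R) = e / 2 * n%:R.
  by rewrite /d invfM !mulrA mulfVK ?gt_eqF.
(* What remains is [C <= e / 2 * n], true for all large [n]. *)
rewrite (mulrC n%:R) {2}(splitr e) mulrDl lerD2r -ler_pdivrMl ?divr_gt0//.
near: n; exact: nbhs_infty_ger.
Unshelve. all: by end_near.
Qed.

Theorem theorem1p2 (R : realType) (x : nat -> R)
  (x_ge0 : forall n : nat, (1 <= n)%N -> 0 <= x n)
  (x_bounded : [bounded x n | n in [set n : nat | (1 <= n)%N]]) :
  (cesaro_cvg x 0 <->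
     exists a : R, 1 < a /\ geom_block_mean x a @ \oo --> (0 : R)) /\
  (cesaro_cvg x 0 -> strong_cesaro_cvg x 0).
Proof.
split; first split=> [cx|[a [a1 ca]]].
- exists 2; split; first by rewrite ltr1n.
  exact: cesaro_cvg_geom_block_mean.
- exact: geom_block_mean_cesaro_cvg ca.
suff abs_x : (fun n : nat => n%:R^-1 * \sum_(1 <= k < n.+1) `|x k - 0|) =
    (fun n : nat => n%:R^-1 * \sum_(1 <= k < n.+1) x k).
  by rewrite /strong_cesaro_cvg abs_x.
apply/funext => n; congr (_ * _); apply: eq_big_nat => k /andP[k1 _].
by rewrite subr0 ger0_norm ?x_ge0.
Qed.
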